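(* APMF is complete for the equational theory of the class of cancellation pmf-structures: for every equation $t=r$ between terms of the same sort over the signature described in the context (with variables of sort $E$ and of sort $S$), if $t=r$ holds (under all valuations) in every cancellation pmf-structure, then $t=r$ is derivable from APMF in equational logic.
   Context: Two-sorted signature: an event sort $E$ with binary operations $\vee,\wedge$, unary $\neg$, constants $\top,\bot$; a stalk sort $S$ with binary $+,\cdot$, unary $-$ (additive inverse), unary ${}^{-1}$ (inverse), unary $\mathbf{s}$ (sign), constants $0,1$; and a function symbol $P:E\to S$. Abbreviations: $p-q=p+(-q)$, $1_p=p\cdot p^{-1}$, $0_p=1-1_p$. APMF is the following set of equations. Boolean algebra: $(x\vee y)\wedge y=y$; $(x\wedge y)\vee y=y$; $x\wedge(y\vee z)=(y\wedge x)\vee(z\wedge x)$; $x\vee(y\wedge z)=(y\vee x)\wedge(z\vee x)$; $x\wedge\neg x=\bot$; $x\vee\neg x=\top$. Meadow: $(x+y)+z=x+(y+z)$; $x+y=y+x$; $x+0=x$; $x+(-x)=0$; $(x\cdot y)\cdot z=x\cdot(y\cdot z)$; $x\cdot y=y\cdot x$; $1\cdot x=x$; $x\cdot(y+z)=x\cdot y+x\cdot z$; $(x^{-1})^{-1}=x$; $x\cdot(x\cdot x^{-1})=x$. Sign: $\mathbf{s}(1_x)=1_x$; $\mathbf{s}(0_x)=0_x$; $\mathbf{s}(-1)=-1$; $\mathbf{s}(x^{-1})=\mathbf{s}(x)$; $\mathbf{s}(x\cdot y)=\mathbf{s}(x)\cdot\mathbf{s}(y)$; $0_{\mathbf{s}(x)-\mathbf{s}(y)}\cdot(\mathbf{s}(x+y)-\mathbf{s}(x))=0$.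 Pmf (with $x,y$ of sort $E$): $P(\top)=1$; $P(\bot)=0$; $\mathbf{s}(\mathbf{s}(P(x))+1)=1$; $P(x\vee y)=P(x)+P(y)-P(x\wedge y)$; $P(x\wedge y)\cdot P(y)\cdot P(y)^{-1}=P(x\wedge y)$. A pmf-structure is a structure for this signature satisfying all equations of APMF. It is a cancellation pmf-structure if its $S$-part additionally satisfies the inverse law: for all $x\in S$, $x\neq 0\Rightarrow x\cdot x^{-1}=1$. *)

(* Defs.v *)
Inductive sort : Set := Event | Stalk.

(* Countably many variables [Var s n] of each sort [s]. *)
Inductive term : sort -> Set :=
| Var (s : sort) (n : nat) : term s
| Or (a b : term Event) : term Event
| And (a b : term Event) : term Event
| Not (a : term Event) : term Event
| Top : term Event
| Bot : term Event
| Add (p q : term Stalk) : term Stalk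
| Mul (p q : term Stalk) : term Stalk
| Opp (p : term Stalk) : term Stalk
| Inv (p : term Stalk) : term Stalk
| Sgn (p : term Stalk) : term Stalk
| Zero : term Stalk
| One : term Stalk
| Prb (a : term Event) : term Stalk.

Record structure : Type := Structure {
  carrier : sort -> Type;
  iOr : carrier Event -> carrier Event -> carrier Event;
  iAnd : carrier Event -> carrier Event -> carrier Event;
  iNot : carrier Event -> carrier Event;
  iTop : carrier Event;
  iBot : carrier Event;
  iAdd : carrier Stalk -> carrier Stalk -> carrier Stalk;
  iMul : carrier Stalk -> carrier Stalk -> carrier Stalk;
  iOpp : carrier Stalk -> carrier Stalk;
  iInv : carrier Stalk -> carrier Stalk;
  iSgn : carrier Stalk -> carrier Stalk;
  iZero : carrier Stalk;
  iOne : carrier Stalk;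
  iPrb : carrier Event -> carrier Stalk
}.

Definition valuation (M : structure) : Type := forall s : sort, nat -> carrier M s.

Fixpoint eval (M : structure) (v : valuation M) (s : sort) (t : term s)
  : carrier M s :=
  match t in term s0 return carrier M s0 with
  | Var s0 n => v s0 n
  | Or a b => iOr M (eval M v Event a) (eval M v Event b)
  | And a b => iAnd M (eval M v Event a) (eval M v Event b)
  | Not a => iNot M (eval M v Event a)
  | Top => iTop M
  | Bot => iBot M
  | Add p q => iAdd M (eval M v Stalk p) (eval M v Stalk q)
  | Mul p q => iMul M (eval M v Stalk p) (eval M v Stalk q)
  | Opp p => iOpp M (eval M v Stalk p)
  | Inv p => iInv M (eval M v Stalk p)
  | Sgn p => iSgn M (eval M v Stalk p)
  | Zero => iZero M
  | One => iOne M
  | Prb a => iPrb M (eval M v Event a)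
  end.

Arguments eval {M} v {s} t.

Definition holds (M : structure) (s : sort) (t r : term s) : Prop :=
  forall v : valuation M, eval v t = eval v r.

Arguments holds M {s} t r.

Definition substitution : Type := forall s : sort, nat -> term s.

Fixpoint subst (f : substitution) (s : sort) (t : term s) : term s :=
  match t in term s0 return term s0 with
  | Var s0 n => f s0 n
  | Or a b => Or (subst f Event a) (subst f Event b)
  | And a b => And (subst f Event a) (subst f Event b)
  | Not a => Not (subst f Event a)
  | Top => Top
  | Bot => Bot
  | Add p q => Add (subst f Stalk p) (subst f Stalk q)
  | Mul p q => Mul (subst f Stalk p) (subst f Stalk q)
  | Opp p => Opp (subst f Stalk p)
  | Inv p => Inv (subst f Stalk p)
  | Sgn p => Sgn (subst f Stalk p)
  | Zero => Zero
  | One => One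
  | Prb a => Prb (subst f Event a)
  end.

Arguments subst f {s} t.

Definition equations : Type := forall s : sort, term s -> term s -> Prop.

Inductive derivable (Ax : equations) : forall s : sort, term s -> term s -> Prop :=
| d_ax (s : sort) (t r : term s) : Ax s t r -> derivable Ax s t r
| d_refl (s : sort) (t : term s) : derivable Ax s t t
| d_sym (s : sort) (t r : term s) : derivable Ax s t r -> derivable Ax s r t
| d_trans (s : sort) (t r u : term s) :
    derivable Ax s t r -> derivable Ax s r u -> derivable Ax s t u
| d_subst (f : substitution) (s : sort) (t r : term s) :
    derivable Ax s t r -> derivable Ax s (subst f t) (subst f r)
| d_Or (a a' b b' : term Event) :
    derivable Ax Event a a' -> derivable Ax Event b b' ->
    derivable Ax Event (Or a b) (Or a' b')
| d_And (a a' b b' : term Event) :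
    derivable Ax Event a a' -> derivable Ax Event b b' ->
    derivable Ax Event (And a b) (And a' b')
| d_Not (a a' : term Event) :
    derivable Ax Event a a' -> derivable Ax Event (Not a) (Not a')
| d_Add (p p' q q' : term Stalk) :
    derivable Ax Stalk p p' -> derivable Ax Stalk q q' ->
    derivable Ax Stalk (Add p q) (Add p' q')
| d_Mul (p p' q q' : term Stalk) :
    derivable Ax Stalk p p' -> derivable Ax Stalk q q' ->
    derivable Ax Stalk (Mul p q) (Mul p' q')
| d_Opp (p p' : term Stalk) :
    derivable Ax Stalk p p' -> derivable Ax Stalk (Opp p) (Opp p')
| d_Inv (p p' : term Stalk) :
    derivable Ax Stalk p p' -> derivable Ax Stalk (Inv p) (Inv p')
| d_Sgn (p p' : term Stalk) :
    derivable Ax Stalk p p' -> derivable Ax Stalk (Sgn p) (Sgn p')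
| d_Prb (a a' : term Event) :
    derivable Ax Event a a' -> derivable Ax Stalk (Prb a) (Prb a').

Arguments derivable Ax {s} t r.

Definition Sub (p q : term Stalk) : term Stalk := Add p (Opp q).
(* [OneAt p] is 1_p and [ZeroAt p] is 0_p. *)
Definition OneAt (p : term Stalk) : term Stalk := Mul p (Inv p).
Definition ZeroAt (p : term Stalk) : term Stalk := Sub One (OneAt p).

Section APMF.

Local Notation "a \/ b" := (Or a b).
Local Notation "a /\ b" := (And a b).
Local Notation "~ a" := (Not a).
Local Notation "p + q" := (Add p q).
Local Notation "p - q" := (Sub p q).
Local Notation "p * q" := (Mul p q).
Local Notation "- p" := (Opp p).
Local Notation "/ p" := (Inv p).
Local Notation "0" := Zero.
Local Notation "1" := One.

Local Notation a := (Var Event 0%nat).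
Local Notation b := (Var Event 1%nat).
Local Notation c := (Var Event 2%nat).
Local Notation x := (Var Stalk 0%nat).
Local Notation y := (Var Stalk 1%nat).
Local Notation z := (Var Stalk 2%nat).

Inductive APMF : forall s : sort, term s -> term s -> Prop :=
| ba_absorb_or : APMF Event ((a \/ b) /\ b) b
| ba_absorb_and : APMF Event ((a /\ b) \/ b) b
| ba_distr_and : APMF Event (a /\ (b \/ c)) ((b /\ a) \/ (c /\ a))
| ba_distr_or : APMF Event (a \/ (b /\ c)) ((b \/ a) /\ (c \/ a))
| ba_compl_and : APMF Event (a /\ ~ a) Bot
| ba_compl_or : APMF Event (a \/ ~ a) Top
| md_addA : APMF Stalk ((x + y) + z) (x + (y + z))
| md_addC : APMF Stalk (x + y) (y + x)
| md_add0 : APMF Stalk (x + 0) x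
| md_addN : APMF Stalk (x + - x) 0
| md_mulA : APMF Stalk ((x * y) * z) (x * (y * z))
| md_mulC : APMF Stalk (x * y) (y * x)
| md_mul1 : APMF Stalk (1 * x) x
| md_distr : APMF Stalk (x * (y + z)) (x * y + x * z)
| md_invK : APMF Stalk (/ (/ x)) x
| md_ril : APMF Stalk (x * (x * / x)) x
| sg_one : APMF Stalk (Sgn (OneAt x)) (OneAt x)
| sg_zero : APMF Stalk (Sgn (ZeroAt x)) (ZeroAt x)
| sg_opp1 : APMF Stalk (Sgn (Opp 1)) (Opp 1)
| sg_inv : APMF Stalk (Sgn (/ x)) (Sgn x)
| sg_mul : APMF Stalk (Sgn (x * y)) (Sgn x * Sgn y)
| sg_add : APMF Stalk (ZeroAt (Sgn x - Sgn y) * (Sgn (x + y) - Sgn x)) 0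
| pm_top : APMF Stalk (Prb Top) 1
| pm_bot : APMF Stalk (Prb Bot) 0
| pm_nonneg : APMF Stalk (Sgn (Sgn (Prb a) + 1)) 1
| pm_or : APMF Stalk (Prb (a \/ b)) (Prb a + Prb b - Prb (a /\ b))
| pm_and : APMF Stalk (Prb (a /\ b) * Prb b * / Prb b) (Prb (a /\ b)).

End APMF.

Definition pmf_structure (M : structure) : Prop :=
  forall (s : sort) (t r : term s), APMF s t r -> holds M t r.

Definition inverse_law (M : structure) : Prop :=
  forall x : carrier M Stalk, x <> iZero M -> iMul M x (iInv M x) = iOne M.

(* As the inverse law is the only extra requirement, structures with a
   one-element stalk are included. *)
Definition cancellation_pmf_structure (M : structure) : Prop :=
  pmf_structure M /\ inverse_law M.

(* Main.v *)
From Stdlib Require Import Ring.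
From mathcomp Require Import boolp classical_sets.
Require Import Defs.

(** For events it suffices to collapse the stalk of the term model of APMF to
    a point, since one-element stalks are cancellation structures. For the
    stalk sort, every pmf-structure is separated by its cancellation quotients:
    given x <> y, Zorn's lemma yields an ideal I of the stalk maximal among
    those avoiding x - y. Such an ideal is maximal, so the quotient satisfies
    the inverse law, and in a signed meadow every maximal ideal is compatible
    with inverse and sign; events are left untouched. Applied to the term model
    this refutes every underivable equation in a cancellation pmf-structure. *)

(** * Quotients by congruences *)

Record congruence (M : structure)
    (E : forall s : sort, carrier M s -> carrier M s -> Prop) : Prop := {
  cong_refl : forall s x, E s x x;
  cong_sym : forall s x y, E s x y -> E s y x;
  cong_trans : forall s x y z, E s x y -> E s y z -> E s x z;
  cong_Or : forall a a' b b', E Event a a' -> E Event b b' ->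
    E Event (iOr M a b) (iOr M a' b');
  cong_And : forall a a' b b', E Event a a' -> E Event b b' ->
    E Event (iAnd M a b) (iAnd M a' b');
  cong_Not : forall a a', E Event a a' -> E Event (iNot M a) (iNot M a');
  cong_Add : forall p p' q q', E Stalk p p' -> E Stalk q q' ->
    E Stalk (iAdd M p q) (iAdd M p' q');
  cong_Mul : forall p p' q q', E Stalk p p' -> E Stalk q q' ->
    E Stalk (iMul M p q) (iMul M p' q');
  cong_Opp : forall p p', E Stalk p p' -> E Stalk (iOpp M p) (iOpp M p');
  cong_Inv : forall p p', E Stalk p p' -> E Stalk (iInv M p) (iInv M p');
  cong_Sgn : forall p p', E Stalk p p' -> E Stalk (iSgn M p) (iSgn M p');
  cong_Prb : forall a a', E Event a a' -> E Stalk (iPrb M a) (iPrb M a')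
}.

Section Quotient.

Variables (M : structure)
  (E : forall s : sort, carrier M s -> carrier M s -> Prop)
  (congE : congruence M E).

(** Classes are predicates, so that by extensionality congruent elements have Leibniz-equal classes,
    as [holds] demands. *)
Definition quot_carrier (s : sort) : Type :=
  {C : carrier M s -> Prop | exists x, C = E s x}.

Definition quot_class {s : sort} (x : carrier M s) : quot_carrier s :=
  exist _ (E s x) (ex_intro _ x eq_refl).

Definition quot_repr {s : sort} (C : quot_carrier s) : carrier M s :=
  proj1_sig (cid (proj2_sig C)).

Lemma quot_class_eq {s : sort} (x y : carrier M s) :
  quot_class x = quot_class y <-> E s x y.
Proof.
split.
- intro H. assert (K : E s x = E s y) by exact (f_equal (@proj1_sig _ _) H).
  rewrite K. apply (cong_refl _ _ congE).
- intro H. apply eq_exist. apply funext; intro z. apply propext; split; intro K.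
  + exact (cong_trans _ _ congE _ _ _ _ (cong_sym _ _ congE _ _ _ H) K).
  + exact (cong_trans _ _ congE _ _ _ _ H K).
Qed.

Lemma quot_classK {s : sort} (C : quot_carrier s) :
  quot_class (quot_repr C) = C.
Proof.
destruct C as [C HC]. unfold quot_repr; simpl. destruct (cid HC) as [x Hx].
simpl. apply eq_exist. symmetry. exact Hx.
Qed.

Lemma quot_reprK {s : sort} (x : carrier M s) : E s (quot_repr (quot_class x)) x.
Proof. apply quot_class_eq, quot_classK. Qed.

Definition quotient : structure := {|
  carrier := quot_carrier;
  iOr := fun a b => quot_class (iOr M (quot_repr a) (quot_repr b));
  iAnd := fun a b => quot_class (iAnd M (quot_repr a) (quot_repr b));
  iNot := fun a => quot_class (iNot M (quot_repr a));
  iTop := quot_class (iTop M);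
  iBot := quot_class (iBot M);
  iAdd := fun p q => quot_class (iAdd M (quot_repr p) (quot_repr q));
  iMul := fun p q => quot_class (iMul M (quot_repr p) (quot_repr q));
  iOpp := fun p => quot_class (iOpp M (quot_repr p));
  iInv := fun p => quot_class (iInv M (quot_repr p));
  iSgn := fun p => quot_class (iSgn M (quot_repr p));
  iZero := quot_class (iZero M);
  iOne := quot_class (iOne M);
  iPrb := fun a => quot_class (iPrb M (quot_repr a))
|}.

Lemma eval_quotient (v : valuation M) (s : sort) (t : term s) :
  @eval quotient (fun s n => quot_class (v s n)) s t = quot_class (eval v t).
Proof.
induction t; simpl; try reflexivity;
  repeat match goal with H : eval _ _ = _ |- _ => rewrite H; clear H end;
  apply quot_class_eq;
  [ apply (cong_Or _ _ congE) | apply (cong_And _ _ congE)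
  | apply (cong_Not _ _ congE) | apply (cong_Add _ _ congE)
  | apply (cong_Mul _ _ congE) | apply (cong_Opp _ _ congE)
  | apply (cong_Inv _ _ congE) | apply (cong_Sgn _ _ congE)
  | apply (cong_Prb _ _ congE) ]; apply quot_reprK.
Qed.

(** By choice of representatives, every valuation of the quotient is the projection of a valuation
    of [M], so [eval_quotient] decides validity. *)
Lemma holds_quotient (s : sort) (t r : term s) :
  holds quotient t r <-> forall v : valuation M, E s (eval v t) (eval v r).
Proof.
split.
- intros H v. apply quot_class_eq. rewrite <- !eval_quotient. apply H.
- intros H v.
  assert (K : v = fun s n => quot_class (quot_repr (v s n))).
  { apply functional_extensionality_dep; intro s0.
    apply funext; intro n. symmetry. apply quot_classK. }
  rewrite K, !eval_quotient. apply quot_class_eq, H.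
Qed.

Lemma pmf_structure_quotient : pmf_structure M -> pmf_structure quotient.
Proof.
intros HM s t r Ax. apply holds_quotient; intro v.
rewrite (HM _ _ _ Ax v). apply (cong_refl _ _ congE).
Qed.

End Quotient.

(** * The term model *)

Definition term_structure : structure :=
  Structure term Or And Not Top Bot Add Mul Opp Inv Sgn Zero One Prb.

Lemma eval_term_structure (v : valuation term_structure) (s : sort)
    (t : term s) : eval v t = subst v t.
Proof.
induction t; simpl in *;
  repeat match goal with H : eval _ _ = _ |- _ => rewrite H; clear H end;
  reflexivity.
Qed.

Lemma subst_Var (s : sort) (t : term s) : subst Var t = t.
Proof.
induction t; simpl;
  repeat match goal with H : subst _ _ = _ |- _ => rewrite H; clear H end;
  reflexivity.
Qed.

Lemma congruence_derivable (Ax : equations) :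
  congruence term_structure (@derivable Ax).
Proof.
split; simpl; intros; eauto using d_refl, d_sym, d_trans, d_Or, d_And, d_Not,
  d_Add, d_Mul, d_Opp, d_Inv, d_Sgn, d_Prb.
Qed.

Definition term_model (Ax : equations) : structure :=
  quotient term_structure (@derivable Ax).

Lemma pmf_structure_term_model : pmf_structure (term_model APMF).
Proof.
intros s t r Ax. apply holds_quotient; [apply congruence_derivable|].
intro v. rewrite !eval_term_structure. apply d_subst, d_ax, Ax.
Qed.

(** Under the generic valuation [Var] every term evaluates to its own class. *)
Lemma derivable_term_model (Ax : equations) (s : sort) (t r : term s) :
  holds (term_model Ax) t r -> derivable Ax t r.
Proof.
intro H.
apply (holds_quotient _ _ (congruence_derivable Ax)) with (v := Var) in H.
now rewrite !eval_term_structure, !subst_Var in H.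
Qed.

(** * Collapsing the stalk *)

(** This is a congruence because no operation leads from the stalk back to events: [iPrb] only maps
    into the collapsed sort. *)
Definition collapse_stalk (M : structure) (s : sort) :
    carrier M s -> carrier M s -> Prop :=
  match s with Event => eq | Stalk => fun _ _ => True end.

Lemma congruence_collapse_stalk (M : structure) :
  congruence M (collapse_stalk M).
Proof.
split; simpl; try (intros; subst; exact I); try (intros; subst; reflexivity).
- now intros [].
- intros []; simpl; congruence.
- intros []; simpl; congruence.
Qed.

Lemma cancellation_collapse_stalk (M : structure) :
  pmf_structure M ->
  cancellation_pmf_structure (quotient M (collapse_stalk M)).
Proof.
intro HM. split.
- apply pmf_structure_quotient; [apply congruence_collapse_stalk | exact HM].
- intros x _. apply quot_class_eq; [apply congruence_collapse_stalk | exact I].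
Qed.

(** * Maximal ideals of the stalk *)

Section Stalk.

Variables (M : structure) (pmfM : pmf_structure M).

Local Notation S := (carrier M Stalk).
Local Notation "0" := (iZero M).
Local Notation "1" := (iOne M).
Local Notation "x + y" := (iAdd M x y).
Local Notation "x * y" := (iMul M x y).
Local Notation "- x" := (iOpp M x).
Local Notation "x - y" := (iAdd M x (iOpp M y)).
Local Notation "/ x" := (iInv M x).
Local Notation sgn := (iSgn M).

(** The stalk variables 0, 1, 2 of the axioms receive [x], [y], [z]; the value [iTop M] for event
    variables is an arbitrary default. *)
Let stalk_valuation (x y z : S) : valuation M := fun s =>
  match s with
  | Event => fun _ => iTop M
  | Stalk => fun n => match n with 0%nat => x | 1%nat => y | _ => z end
  end.

Let stalk_axiom (t r : term Stalk) (Ax : APMF Stalk t r) (x y z : S) :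
  eval (stalk_valuation x y z) t = eval (stalk_valuation x y z) r :=
  pmfM Stalk t r Ax (stalk_valuation x y z).

Lemma stalk_ring : ring_theory 0 1 (iAdd M) (iMul M) (fun x y => x - y) (iOpp M) eq.
Proof.
pose proof (fun x => stalk_axiom _ _ md_add0 x x x) as add0.
pose proof (fun x y => stalk_axiom _ _ md_addC x y y) as addC.
pose proof (fun x y => stalk_axiom _ _ md_mulC x y y) as mulC.
simpl in add0, addC, mulC.
split.
- intro x. now rewrite addC.
- exact addC.
- intros x y z. symmetry. exact (stalk_axiom _ _ md_addA x y z).
- intro x. exact (stalk_axiom _ _ md_mul1 x x x).
- exact mulC.
- intros x y z. symmetry. exact (stalk_axiom _ _ md_mulA x y z).
- intros x y z. rewrite !(mulC _ z). exact (stalk_axiom _ _ md_distr z x y).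
- reflexivity.
- intro x. exact (stalk_axiom _ _ md_addN x x x).
Qed.

Add Ring stalk_ring_inst : stalk_ring.

Lemma mulrV (x : S) : x * (x * / x) = x.
Proof. exact (stalk_axiom _ _ md_ril x x x). Qed.

Lemma invrK (x : S) : / / x = x.
Proof. exact (stalk_axiom _ _ md_invK x x x). Qed.

Lemma sgnM (x y : S) : sgn (x * y) = sgn x * sgn y.
Proof. exact (stalk_axiom _ _ sg_mul x y y). Qed.

Lemma sgn_zero_at (x : S) : sgn (1 - x * / x) = 1 - x * / x.
Proof. exact (stalk_axiom _ _ sg_zero x x x). Qed.

(* The empty set is allowed, so that unions of chains, including the empty
   one, stay in the class. *)
Definition ideal (A : set S) : Prop :=
  (forall x y, A x -> A y -> A (x + y)) /\ (forall r x, A x -> A (r * x)).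

Lemma exists_maximal_ideal (e : S) : e <> 0 ->
  exists A : set S, (ideal A /\ A 0 /\ ~ A e) /\
    forall B : set S, ideal B -> ~ B e -> (forall x, A x -> B x) ->
      forall x, B x -> A x.
Proof.
intro e0.
destruct (@Zorn_bigcup S (fun A => ideal A /\ ~ A e)) as [A [[idA Ae] maxA]].
- intros F FP Ftot. split; [split|].
  + intros x y [X FX Xx] [Y FY Yy].
    destruct (Ftot X Y FX FY) as [XY|YX].
    * exists Y; [exact FY|]. apply (FP Y FY); [apply XY, Xx | exact Yy].
    * exists X; [exact FX|]. apply (FP X FX); [exact Xx | apply YX, Yy].
  + intros r x [X FX Xx]. exists X; [exact FX|]. apply (FP X FX), Xx.
  + intros [X FX Xe]. exact (proj2 (FP X FX) Xe).
- assert (max : forall B : set S, ideal B -> ~ B e -> (forall x, A x -> B x) ->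
      forall x, B x -> A x).
  { intros B idB Be AB x Bx. destruct (EM (A x)) as [Ax|nAx]; [exact Ax|].
    exfalso. apply (maxA B); [|split; assumption].
    split; [exact AB|]. intro BA. exact (nAx (BA x Bx)). }
  exists A. split; [split; [exact idA|split; [|exact Ae]]|exact max].
  destruct (EM (A 0)) as [A0|nA0]; [exact A0|].
  (* Without 0 the set [A] would be empty; then {0} is an ideal above it that avoids [e], and
     maximality puts 0 into [A] after all. *)
  assert (A_empty : forall x, ~ A x).
  { intros x Ax. apply nA0. replace 0 with (0 * x) by ring. now apply idA. }
  apply (max (fun x => x = 0)); auto.
  + split; [intros x y -> ->|intros r x ->]; ring.
  + intros x Ax. destruct (A_empty x Ax).
Qed.

(** * Compatibility of a maximal ideal with inverse and sign *)

Definition ideal_cong (A : set S) (s : sort) :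
    carrier M s -> carrier M s -> Prop :=
  match s with Event => eq | Stalk => fun x y => A (x - y) end.

Section MaximalIdeal.

Variables (A : set S) (e : S).
Hypotheses (idA : ideal A) (A0 : A 0) (Ae : ~ A e)
  (maxA : forall B : set S, ideal B -> ~ B e -> (forall x, A x -> B x) ->
     forall x, B x -> A x).

Let idealD (x y : S) : A x -> A y -> A (x + y) := proj1 idA x y.
Let idealM (r x : S) : A x -> A (r * x) := proj2 idA r x.

(** By maximality the ideal A + Sx contains [e], say e = a + r x. Since 1 - x/x kills [x], the
    product is a (1 - x/x). *)
Lemma ideal_zero_at_mul (x : S) : ~ A x -> A (e * (1 - x * / x)).
Proof.
intro Ax.
destruct (EM (exists a r, A a /\ e = a + r * x)) as [[a [r [Aa He]]]|nBe].
- replace (e * (1 - x * / x)) with ((1 - x * / x) * a).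
  + now apply idealM.
  + rewrite He.
    replace ((a + r * x) * (1 - x * / x))
      with ((1 - x * / x) * a + (r * x - r * (x * (x * / x)))) by ring.
    rewrite mulrV. ring.
(* Otherwise A + Sx still avoids [e], so maximality makes it a subset of [A], although it contains
   [x]. *)
- exfalso. apply Ax.
  apply (maxA (fun y => exists a r, A a /\ y = a + r * x)).
  + split.
    * intros y z [a [r [Aa ->]]] [b [q [Ab ->]]].
      exists (a + b), (r + q). split; [now apply idealD | ring].
    * intros q y [a [r [Aa ->]]].
      exists (q * a), (q * r). split; [now apply idealM | ring].
  + exact nBe.
  + intros y Ay. exists y, 0. split; [exact Ay | ring].
  + exists 0, 1. split; [exact A0 | ring].
Qed.

(* If neither x nor u = 1 - x/x were in A, then e u and e (1 - u/u) would be,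
   hence also e = e (1 - u/u) + (e u)/u. *)
Lemma ideal_zero_at (x : S) : ~ A x -> A (1 - x * / x).
Proof.
intro Ax. pose proof (ideal_zero_at_mul x Ax) as H.
set (u := 1 - x * / x) in *.
destruct (EM (A u)) as [Au|nAu]; [exact Au|].
exfalso. apply Ae.
replace e with (e * (1 - u * / u) + / u * (e * u)) by ring.
apply idealD; [now apply ideal_zero_at_mul | now apply idealM].
Qed.

(** The law x (x/x) = x, applied to the inverse of [x], makes that inverse a multiple of [x]. *)
Lemma ideal_inv (x : S) : A x -> A (/ x).
Proof.
intro Ax. rewrite <- (mulrV (/ x)), invrK.
replace (/ x * (/ x * x)) with ((/ x * / x) * x) by ring. now apply idealM.
Qed.

Lemma ideal_cong_inv (x y : S) : A (x - y) -> A (/ x - / y).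
Proof.
intro Axy.
destruct (EM (A x)) as [Ax|nAx], (EM (A y)) as [Ay|nAy].
- replace (/ x - / y) with (/ x + - (1) * / y) by ring.
  apply idealD; [|apply idealM]; now apply ideal_inv.
- exfalso. apply nAy. replace y with (x + - (1) * (x - y)) by ring.
  apply idealD; [|apply idealM]; assumption.
- exfalso. apply nAx. replace x with ((x - y) + y) by ring.
  now apply idealD.
(* Outside [A], both 1 - x/x and 1 - y/y lie in [A]; the inverses are subtracted as fractions, with
   these two as correction terms. The mixed cases above cannot occur, as x - y is in [A]. *)
- replace (/ x - / y) with
    ((/ x * (1 - y * / y) + - / y * (1 - x * / x)) + (- (/ x * / y)) * (x - y))
    by ring.
  repeat apply idealD; apply idealM; auto using ideal_zero_at.
Qed.

(* With w = x - y and u = 1 - w/w one has u x = u y and s(u) = u, so s(x) - s(y)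
   is killed by u, i.e. it is a multiple of w. *)
Lemma ideal_cong_sgn (x y : S) : A (x - y) -> A (sgn x - sgn y).
Proof.
intro Axy. set (w := x - y) in *. set (u := 1 - w * / w).
assert (Hu : u * x = u * y).
{ assert (K : u * x - u * y = 0).
  { replace (u * x - u * y) with (w - w * (w * / w)).
    - rewrite mulrV. ring.
    - unfold u, w. ring. }
  replace (u * x) with ((u * x - u * y) + u * y) by ring. rewrite K. ring. }
assert (Hs : u * sgn x = u * sgn y).
{ replace u with (sgn u) by apply sgn_zero_at. now rewrite <- !sgnM, Hu. }
replace (sgn x - sgn y) with
  ((u * sgn x - u * sgn y) + (/ w * (sgn x - sgn y)) * w)
  by (unfold u; ring).
rewrite Hs. apply idealD; [|now apply idealM].
now replace (u * sgn y - u * sgn y) with 0 by ring.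
Qed.

Lemma congruence_ideal_cong : congruence M (ideal_cong A).
Proof.
split; simpl; try (intros; subst; reflexivity).
- intros [] x; simpl; [reflexivity|]. now replace (x - x) with 0 by ring.
- intros [] x y; simpl; [congruence|]. intro H.
  replace (y - x) with (- (1) * (x - y)) by ring. now apply idealM.
- intros [] x y z; simpl; [congruence|]. intros H K.
  replace (x - z) with ((x - y) + (y - z)) by ring. now apply idealD.
- intros p p' q q' H K.
  replace ((p + q) - (p' + q')) with ((p - p') + (q - q')) by ring.
  now apply idealD.
- intros p p' q q' H K.
  replace (p * q - p' * q') with (q * (p - p') + p' * (q - q')) by ring.
  apply idealD; now apply idealM.
- intros p p' H. replace (- p - - p') with (- (1) * (p - p')) by ring.
  now apply idealM.
- apply ideal_cong_inv.
- apply ideal_cong_sgn.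
- intros a a' ->. now replace (iPrb M a' - iPrb M a') with 0 by ring.
Qed.

Lemma cancellation_ideal_cong :
  cancellation_pmf_structure (quotient M (ideal_cong A)).
Proof.
pose proof congruence_ideal_cong as cong.
split; [now apply pmf_structure_quotient|].
set (v := fun x : S => stalk_valuation x x x).
intros C HC. rewrite <- (quot_classK M (ideal_cong A) C) in *.
set (x := quot_repr M (ideal_cong A) C) in *.
assert (nAx : ~ A x).
{ intro Ax. apply HC. apply quot_class_eq; [exact cong|]. simpl.
  now replace (x - 0) with x by ring. }
(* Each operation of the quotient picks new representatives; reading x/x as the value of a term
   replaces them all by [x] at once. *)
pose proof (eval_quotient M _ cong (v x) _ (OneAt (Var Stalk 0))) as H.
simpl in H. simpl. rewrite H. apply quot_class_eq; [exact cong|]. simpl.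
replace (x * / x - 1) with (- (1) * (1 - x * / x)) by ring.
now apply idealM, ideal_zero_at.
Qed.

End MaximalIdeal.

(** * Separation by cancellation quotients, and completeness *)

Theorem stalk_separation (x y : S) : x <> y ->
  exists E, congruence M E /\ cancellation_pmf_structure (quotient M E) /\
    ~ E Stalk x y.
Proof.
intro xy.
destruct (exists_maximal_ideal (x - y)) as [A [[idA [A0 Ae]] maxA]].
- intro H. apply xy. replace x with ((x - y) + y) by ring. rewrite H. ring.
- exists (ideal_cong A). split; [|split].
  + eapply congruence_ideal_cong; eassumption.
  + eapply cancellation_ideal_cong; eassumption.
  + exact Ae.
Qed.

End Stalk.

Theorem theorem3 (s : sort) (t r : term s)
    (valid : forall M : structure, cancellation_pmf_structure M -> holds M t r) :
  derivable APMF t r.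
Proof.
pose proof pmf_structure_term_model as pmfT.
apply derivable_term_model. intro v. destruct s.
(* On events the collapsing congruence is equality, so validity in the quotient is validity in the
   term model. *)
- exact (proj1 (holds_quotient _ _ (congruence_collapse_stalk _) _ _ _)
    (valid _ (cancellation_collapse_stalk _ pmfT)) v).
(* Distinct values would stay distinct in some cancellation quotient, where the equation is
   valid. *)
- destruct (EM (eval v t = eval v r)) as [eq_tr|neq_tr]; [exact eq_tr|].
  destruct (stalk_separation _ pmfT _ _ neq_tr) as [E [congE [cancE nE]]].
  destruct nE.
  exact (proj1 (holds_quotient _ _ congE _ _ _) (valid _ cancE) v).
Qed.
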